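(* Let $u_0$ be an admissible initial value with $\|u_0\|\le 1$ and $|M_0|\neq|\Omega|$, where $M_0=\int_\Omega u_0(\mathbf{x})\,\mathrm{d}\mathbf{x}$, and let $\kappa\ge \max_{|\xi|\le 1}(|f'(\xi)|+|g'(\xi)|)=4$. Then for any time step size $\tau>0$, the solution $\{u^n\}_{n\ge 0}$ of the ETDRK2 scheme satisfies $$\int_\Omega u^{n}(\mathbf{x})\,\mathrm{d}\mathbf{x}=M_0,\qquad \forall\, n\ge 0.$$
   Context: Let $\Omega\subset\mathbb{R}^d$ ($d=2,3$) be open, connected and bounded with Lipschitz boundary, $\varepsilon>0$, and let $\|\cdot\|$ be the supremum norm on $C(\overline\Omega)$. Boundary conditions: either homogeneous Neumann ($\partial u/\partial\mathbf{n}=0$ on $\partial\Omega$), or periodic, in which case $\Omega=\prod_{i=1}^d(a_i,b_i)$ and all functions, including $u_0$, are periodic. An admissible initial value is $u_0\in C(\overline\Omega)$ (periodic in the periodic case). Put $f(s)=s-s^3$, $g(s)=1-s^2$, and for $\xi\in C(\overline\Omega)$ with $\int_\Omega g(\xi)\,\mathrm{d}\mathbf{x}\ne0$, $$\lambda_\xi=\frac{\int_\Omega f(\xi(\mathbf{x}))\,\mathrm{d}\mathbf{x}}{\int_\Omega g(\xi(\mathbf{x}))\,\mathrm{d}\mathbf{x}},\qquad \mathcal{N}[\xi]=\kappa\xi+f(\xi)-\lambda_\xi\, g(\xi).$$ Let $\mathcal{L}_\kappa=\varepsilon^2\Delta-\kappa\mathcal{I}$, where $\Delta$ is the Laplacian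 with the chosen boundary condition; $\{e^{t\Delta}\}_{t\ge0}$ is the contraction semigroup it generates with respect to the supremum norm (on $C(\overline\Omega)$, or its subspace of periodic functions in the periodic case), and $e^{t\mathcal{L}_\kappa}=e^{-\kappa t}e^{t\varepsilon^2\Delta}$. ETDRK2 scheme with step $\tau>0$: $u^0=u_0$, and for $n\ge 0$, $u^{n+1}=w^n(\tau)$, where $w^n$ solves $\partial_s w^n=\mathcal{L}_\kappa w^n+(1-\frac{s}{\tau})\mathcal{N}[u^n]+\frac{s}{\tau}\mathcal{N}[\tilde u^{n+1}]$ in $\Omega$ for $s\in(0,\tau]$, $w^n(\cdot,0)=u^n$, with the chosen boundary condition, and $\tilde u^{n+1}$ is obtained from $u^n$ by one step of the first-order ETD1 scheme. Equivalently, $$\tilde u^{n+1}=e^{\tau\mathcal{L}_\kappa}u^n+\int_0^\tau e^{(\tau-s)\mathcal{L}_\kappa}\mathcal{N}[u^n]\,\mathrm{d}s,$$ $$u^{n+1}=e^{\tau\mathcal{L}_\kappa}u^n+\int_0^\tau e^{(\tau-s)\mathcal{L}_\kappa}\Big[\Big(1-\frac{s}{\tau}\Big)\mathcal{N}[u^n]+\frac{s}{\tau}\mathcal{N}[\tilde u^{n+1}]\Big]\,\mathrm{d}s.$$ *)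

(* Defs.v *)
From HB Require Import structures.
From mathcomp Require Import all_boot all_order all_algebra.
From mathcomp Require Import lra.
From mathcomp Require Import all_classical all_reals all_analysis.

Set Implicit Arguments.
Unset Strict Implicit.
Unset Printing Implicit Defensive.

Import Order.TTheory GRing.Theory Num.Theory.
Import numFieldNormedType.Exports.

Local Open Scope classical_set_scope.
Local Open Scope ring_scope.

(* The Borel sigma-algebra of R^n, generated by the coordinate functions (same
   construction as the library's structure on [n.-tuple]). *)
Section rV_measurable.
Context (R : realType) (n : nat).

Let coord (i : 'I_n) (x : 'rV[R]_n) : measurableTypeR R := x 0 i.

Let rV_set0 : g_sigma_preimage coord set0.
Proof. exact: sigma_algebra0. Qed.

Let rV_setC A : g_sigma_preimage coord A -> g_sigma_preimage coord (~` A).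
Proof. exact: sigma_algebraC. Qed.

Let rV_bigcup (F : (set 'rV[R]_n)^nat) :
  (forall i, g_sigma_preimage coord (F i)) ->
  g_sigma_preimage coord (\bigcup_i F i).
Proof. exact: sigma_algebra_bigcup. Qed.

HB.instance Definition _ := @isMeasurable.Build default_measure_display
  'rV[R]_n (g_sigma_preimage coord) rV_set0 rV_setC rV_bigcup.

Lemma measurable_rV_coord (i : 'I_n) :
  measurable_fun [set: 'rV[R]_n] (fun x => x 0 i : measurableTypeR R).
Proof.
move=> _ Y mY; rewrite setTI; apply: sub_sigma_algebra => /=.
rewrite -bigcup_seq/=; exists i => /=; first by rewrite mem_index_enum.
by exists Y => //; rewrite setTI.
Qed.

Lemma measurable_fun_rVP d (T : measurableType d) (f : T -> 'rV[R]_n) :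
  (forall i, measurable_fun [set: T] (fun t => f t 0 i : measurableTypeR R)) ->
  measurable_fun [set: T] f.
Proof.
move=> mf _ Y mY; rewrite setTI.
suff : (fun A => measurable (f @^-1` A)) Y by [].
move: Y mY; apply: smallest_sub.
  split=> [|A mA|F mF]; first by rewrite preimage_set0.
    by rewrite setTD preimage_setC; exact: measurableC.
  by rewrite preimage_bigcup; exact: bigcup_measurable.
rewrite -bigcup_seq/= => _ [i _ [B mB <-]].
by rewrite setTI -[X in measurable X]setTI; exact: (mf i).
Qed.

End rV_measurable.

Section lebesgue_rV.
Context (R : realType).

Definition rV_cons n (p : measurableTypeR R * 'rV[R]_n) : 'rV[R]_n.+1 :=
  \row_i (if unlift ord0 i is Some j then p.2 0 j else p.1).

Lemma measurable_rV_cons n : measurable_fun setT (@rV_cons n).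
Proof.
apply: measurable_fun_rVP => i.
under eq_fun do rewrite mxE.
case: (unlift ord0 i) => [j|]; last exact: measurable_fst.
exact: (measurableT_comp (measurable_rV_coord j) measurable_snd).
Qed.

Let rV_tail n (x : 'rV[R]_n.+1) : measurableTypeR R * 'rV[R]_n :=
  (x 0 0, \row_j x 0 (lift ord0 j)).

Let measurable_rV_tail n : measurable_fun setT (@rV_tail n).
Proof.
apply/measurable_fun_pairP; split; first exact: measurable_rV_coord.
apply: measurable_fun_rVP => j.
under eq_fun do rewrite mxE.
exact: measurable_rV_coord.
Qed.

Let rV_consK n : cancel (@rV_cons n) (@rV_tail n).
Proof.
case=> a x; congr pair; first by rewrite mxE unlift_none.
by apply/rowP => j; rewrite !mxE liftK.
Qed.

Let sigma_finite_product d1 d2 (T1 : measurableType d1) (T2 : measurableType d2)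
    (m1 : {sigma_finite_measure set T1 -> \bar R})
    (m2 : {sigma_finite_measure set T2 -> \bar R}) :
  sigma_finite setT (m1 \x m2)%E.
Proof.
have /sigma_finiteP[F [TF ndF Foo]] := sigma_finiteT m1.
have /sigma_finiteP[G [TG ndG Goo]] := sigma_finiteT m2.
exists (fun n => F n `*` G n).
  rewrite -setXTT TF TG predeqE => -[x y]; split.
    move=> [/= [n _ Fnx] [k _ Gky]]; exists (maxn n k) => //; split.
    - by move: x Fnx; exact/subsetPset/ndF/leq_maxl.
    - by move: y Gky; exact/subsetPset/ndG/leq_maxr.
  by move=> [n _ []/= ? ?]; split; exists n.
move=> k; have [? ?] := Foo k; have [? ?] := Goo k.
split; first exact: measurableX.
by rewrite product_measure1E// lte_mul_pinfty// ge0_fin_numE.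
Qed.

Section step.
Context n (mu : {sigma_finite_measure set 'rV[R]_n -> \bar R}).

Definition lebesgue_rV_step : set 'rV[R]_n.+1 -> \bar R :=
  pushforward (@lebesgue_measure R \x mu)%E (@rV_cons n).

Let step0 : lebesgue_rV_step set0 = 0%E.
Proof. by rewrite /lebesgue_rV_step /pushforward preimage_set0 measure0. Qed.

Let step_ge0 A : (0 <= lebesgue_rV_step A)%E.
Proof. exact: (measure_ge0 (@lebesgue_measure R \x mu)%E). Qed.

Let step_sigma_additive : semi_sigma_additive lebesgue_rV_step.
Proof.
move=> F mF tF mUF; rewrite /lebesgue_rV_step /pushforward preimage_bigcup.
apply: (@measure_semi_sigma_additive _ _ _ (@lebesgue_measure R \x mu)%E
  (fun k => @rV_cons n @^-1` F k)).
- by move=> k; rewrite -[X in measurable X]setTI; exact: measurable_rV_cons.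
- apply/trivIsetP => /= i j _ _ ij; rewrite -preimage_setI.
  by move/trivIsetP : tF => /(_ _ _ _ _ ij) ->//; rewrite preimage_set0.
- rewrite -preimage_bigcup -[X in measurable X]setTI.
  exact: measurable_rV_cons.
Qed.

HB.instance Definition _ := isMeasure.Build _ _ _ lebesgue_rV_step
  step0 step_ge0 step_sigma_additive.

Let step_sigma_finite : sigma_finite setT lebesgue_rV_step.
Proof.
have [F TF Foo] := sigma_finite_product
  (@lebesgue_measure R) mu.
exists (fun k => @rV_tail n @^-1` F k).
  by rewrite -preimage_bigcup -TF preimage_setT.
move=> k; have [mFk Fkoo] := Foo k; split.
  by rewrite -[X in measurable X]setTI; exact: measurable_rV_tail.
rewrite /lebesgue_rV_step /pushforward -comp_preimage.
rewrite (_ : _ \o _ = id) ?preimage_id//.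
by apply/funext => p /=; rewrite rV_consK.
Qed.

HB.instance Definition _ := Measure_isSigmaFinite.Build _ _ _ lebesgue_rV_step
  step_sigma_finite.

End step.

(* Lebesgue measure on R^n, as an iterated product of one-dimensional ones. *)
Fixpoint lebesgue_rV n : {sigma_finite_measure set 'rV[R]_n -> \bar R} :=
  match n with
  | 0 => \d_(0 : 'rV[R]_0)
  | n'.+1 => lebesgue_rV_step (lebesgue_rV n')
  end.

End lebesgue_rV.

Variant boundary_condition (R : realType) (d : nat) :=
  | Neumann
  | Periodic of 'rV[R]_d & 'rV[R]_d.  (* corners a and b of the box *)
Arguments Neumann {R d}.

Section domain.
Context (R : realType) (d : nat).
Implicit Types (Omega : set 'rV[R]_d) (bc : boundary_condition R d).

(* Near every boundary point, after an orthogonal change of coordinates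
   [x *m Q], the set is the strict epigraph, in the direction of the k-th axis,
   of a Lipschitz function of the remaining coordinates. *)
Definition lipschitz_boundary Omega : Prop :=
  forall x0, (closure Omega `\` Omega°) x0 ->
  exists r : R, exists Q : 'M[R]_d, exists k : 'I_d,
  exists gam : 'rV[R]_d.-1 -> R,
    [/\ 0 < r, Q *m Q^T = 1%:M, lipschitz (gam : 'rV[R]_d.-1 -> R^o) &
      forall x, ball x0 r x ->
        (Omega x <-> gam (col' k (x *m Q)) < (x *m Q) 0 k)].

Definition periodic_domain bc Omega : Prop :=
  if bc is Periodic a b then
    (forall i, a 0 i < b 0 i) /\
    Omega = [set x | forall i, a 0 i < x 0 i < b 0 i]
  else True.

(* On the closed box, this says that u takes the same values at corresponding
   points of opposite faces; on the whole space, it is full periodicity. *)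
Definition periodic_on (D : set 'rV[R]_d) bc (u : 'rV[R]_d -> R) : Prop :=
  if bc is Periodic a b then
    forall (i : 'I_d) x (y := x + (b 0 i - a 0 i) *: delta_mx 0 i),
      D x -> D y -> u y = u x
  else True.

(* C(closure Omega), or its subspace of periodic functions. Elements are total
   functions, of which only the values on [closure Omega] matter. *)
Definition cspace bc Omega : set ('rV[R]_d -> R) :=
  [set u | {within closure Omega, continuous u} /\
           periodic_on (closure Omega) bc u].

Definition supnorm Omega (u : 'rV[R]_d -> R) : R :=
  sup [set `|u x| | x in closure Omega].

Definition integ Omega (u : 'rV[R]_d -> R) : R :=
  \int[lebesgue_rV R d]_(x in Omega) u x.

Definition vol Omega : R := fine (lebesgue_rV R d Omega).

End domain.

Section laplacian.
Context (R : realType) (d : nat).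
Implicit Types (Omega : set 'rV[R]_d) (bc : boundary_condition R d).
Implicit Types (u v phi : 'rV[R]_d -> R) (p : 'I_d -> 'rV[R]_d -> R).

Definition partial (i : 'I_d) phi : 'rV[R]_d -> R :=
  fun x => 'D_(delta_mx 0 i) phi x.

(* C^oo on R^d: all iterated partial derivatives are differentiable. *)
Definition smooth phi : Prop :=
  forall (s : seq 'I_d) x, differentiable (foldr partial phi s) x.

Definition compactly_supported_in Omega phi : Prop :=
  compact (closure [set x | phi x != 0]) /\
  closure [set x | phi x != 0] `<=` Omega.

Definition square_integrable Omega (h : 'rV[R]_d -> R) : Prop :=
  measurable_fun Omega h /\
  (lebesgue_rV R d).-integrable Omega (fun x => (h x ^+ 2)%:E).

Definition weak_gradient Omega u p : Prop :=
  forall phi, smooth phi -> compactly_supported_in Omega phi ->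
  forall i, integ Omega (fun x => u x * partial i phi x) =
            - integ Omega (fun x => p i x * phi x).

(* [laplacian bc Omega u v]: u is in the domain of the Laplacian of the space
   [cspace bc Omega] and v is its image. The boundary condition is understood
   in the usual variational sense: u has a gradient p in L^2, and
     \int p . grad phi = - \int v phi
   for all smooth test functions, up to the boundary in the Neumann case (so
   that both Delta u = v in Omega and du/dn = 0 on the boundary are encoded) and
   periodic in the periodic case. As the boundary is only Lipschitz, the normal
   exists almost everywhere only, and functions in the domain need not be C^1
   up to the boundary. *)
Definition laplacian bc Omega u v : Prop :=
  [/\ cspace bc Omega u, cspace bc Omega v &
    exists p, [/\ forall i, square_integrable Omega (p i),
      weak_gradient Omega u p &
      forall phi, smooth phi -> periodic_on setT bc phi ->
        integ Omega (fun x => \sum_(i < d) p i x * partial i phi x) =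
        - integ Omega (fun x => v x * phi x)]].

(* S is the strongly continuous semigroup of linear contractions of
   [cspace bc Omega], for the supremum norm, whose infinitesimal generator is
   the Laplacian; S is determined on [closure Omega] by this property. *)
Record laplacian_semigroup bc Omega (S : R -> ('rV[R]_d -> R) -> 'rV[R]_d -> R)
    : Prop := {
  semigroup_cspace : forall t u, 0 <= t ->
    cspace bc Omega u -> cspace bc Omega (S t u);
  semigroup_linear : forall t (c : R) u v, 0 <= t ->
    cspace bc Omega u -> cspace bc Omega v ->
    forall x, closure Omega x ->
      S t (fun y => c * u y + v y) x = c * S t u x + S t v x;
  semigroup0 : forall u, cspace bc Omega u ->
    forall x, closure Omega x -> S 0 u x = u x;
  semigroupD : forall s t u, 0 <= s -> 0 <= t -> cspace bc Omega u ->
    forall x, closure Omega x -> S (s + t) u x = S s (S t u) x;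
  semigroup_contraction : forall t u, 0 <= t -> cspace bc Omega u ->
    supnorm Omega (S t u) <= supnorm Omega u;
  semigroup_continuous : forall u, cspace bc Omega u ->
    supnorm Omega (fun x => S t u x - u x) @[t --> 0^'+] --> (0 : R);
  semigroup_generator : forall u v, cspace bc Omega u -> cspace bc Omega v ->
    (supnorm Omega (fun x => t^-1 * (S t u x - u x) - v x) @[t --> 0^'+] -->
       (0 : R)) <-> laplacian bc Omega u v
}.

End laplacian.

Section nonlinearity.
Context (R : realType).

Definition f (s : R) : R := s - s ^+ 3.
Definition g (s : R) : R := 1 - s ^+ 2.

Definition kappa_min : R :=
  sup [set `|derive1 f xi| + `|derive1 g xi| | xi in [set xi : R | `|xi| <= 1]].

Lemma derive1_f xi : derive1 f xi = 1 - 3 * xi ^+ 2.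
Proof.
rewrite derive1E /f deriveB// derive_id exp_derive.
by rewrite -mulr_natl [X in _ - X]mulr1.
Qed.

Lemma derive1_g xi : derive1 g xi = - (2 * xi).
Proof.
rewrite derive1E /g deriveB// derive_cst sub0r exp_derive expr1.
by rewrite -mulr_natl [X in - X]mulr1.
Qed.

Lemma kappa_minE : kappa_min = 4.
Proof.
rewrite /kappa_min; set A := (X in sup X).
have A4 : A 4.
  exists 1; first by rewrite /= normr1.
  rewrite derive1_f derive1_g expr1n !mulr1 normrN ler0_norm; last by lra.
  by rewrite ger0_norm; lra.
have ubA : ubound A 4.
  move=> _ [xi /= xi1 <-]; rewrite derive1_f derive1_g normrN normrM.
  rewrite (ger0_norm (_ : 0 <= 2))// -(real_normK (num_real xi)).
  move: xi1 (normr_ge0 xi); set z := `|xi| => z1 z0.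
  have [h|h] := ler0P (1 - 3 * z ^+ 2); nra.
apply/eqP; rewrite eq_le ge_sup//=; last by exists 4.
by apply: ub_le_sup => //; exists 4.
Qed.

Context (d : nat) (Omega : set 'rV[R]_d).
Implicit Types xi : 'rV[R]_d -> R.

(* Equal to 0 by convention when the denominator vanishes. *)
Definition lambda xi : R :=
  integ Omega (fun x => f (xi x)) / integ Omega (fun x => g (xi x)).

Definition nonlin (kappa : R) xi : 'rV[R]_d -> R :=
  fun x => kappa * xi x + f (xi x) - lambda xi * g (xi x).

End nonlinearity.

Section scheme.
Context (R : realType) (d : nat) (Omega : set 'rV[R]_d).
Context (S : R -> ('rV[R]_d -> R) -> 'rV[R]_d -> R) (eps kappa tau : R).
Implicit Types u : 'rV[R]_d -> R.

(* e^{t L_kappa} *)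
Definition expL (t : R) u : 'rV[R]_d -> R :=
  fun x => expR (- kappa * t) * S (eps ^+ 2 * t) u x.

(* The C(closure Omega)-valued integral is evaluated pointwise. *)
Definition duhamel (F : R -> 'rV[R]_d -> R) u : 'rV[R]_d -> R :=
  fun x => expL tau u x +
    \int[lebesgue_measure]_(s in `[0, tau]) expL (tau - s) (F s) x.

Definition etd1_step u : 'rV[R]_d -> R :=
  duhamel (fun=> nonlin Omega kappa u) u.

Definition etdrk2_step u : 'rV[R]_d -> R :=
  duhamel (fun s x => (1 - s / tau) * nonlin Omega kappa u x +
                      s / tau * nonlin Omega kappa (etd1_step u) x) u.

Definition etdrk2 u0 (n : nat) : 'rV[R]_d -> R := iter n etdrk2_step u0.

End scheme.

(* Main.v *)
Require Import Defs.
From mathcomp Require Import all_boot all_order all_algebra.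
From mathcomp Require Import lra ring.
From mathcomp Require Import all_classical all_reals all_analysis.
From mathcomp Require Import measurable_realfun.

Set Implicit Arguments.
Unset Strict Implicit.
Unset Printing Implicit Defensive.

Import Order.TTheory GRing.Theory Num.Theory.
Import numFieldNormedType.Exports.

Local Open Scope classical_set_scope.
Local Open Scope ring_scope.

(** Each step of the scheme turns u into
      e^{tau L} u + \int_0^tau e^{(tau - s) L} ((1 - s/tau) a + (s/tau) b) ds,
    where L is L_kappa, and where a and b are values of the nonlinear term N at
    functions of the same mass m as u. The mass survives for three reasons.

    The semigroup S of the Laplacian conserves mass ([integ_semigroup]). The
    orbit integral U = \int_0^t S(s) u ds lies in the domain of the generator
    and is mapped to S(t) u - u ([generator_orbit_integral]); the variational
    identity that defines the Laplacian, tested against the constant 1, says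
    that everything in its range has integral zero ([integ_laplacian]).

    The multiplier lambda makes the integral of N[u] equal to kappa m
    ([integ_nonlin]). For this lambda times \int g(u) must be \int f(u), which
    is its definition when \int g(u) is nonzero. As |f| <= g on [-1, 1], the
    bound |u| <= 1 gives |\int f(u)| <= \int g(u); hence the identity persists
    when \int g(u) vanishes ([lambda_cancel]), and |lambda| <= 1.

    So that these facts are available at all steps, the bound |u| <= 1 is
    carried along with the mass ([conserving]). As kappa >= 4 and
    |lambda| <= 1, the term N maps functions bounded by 1 to functions bounded
    by kappa ([nonlin_bound]), and S is contractive. Since
      kappa \int_0^tau e^{- kappa (tau - s)} ds = 1 - e^{- kappa tau},
    the new bound is e^{- kappa tau} + (1 - e^{- kappa tau}) = 1, and by the same
    computation the new mass is m ([duhamel_conserving]).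

    Integrals of curves s |-> F(s) of continuous functions are taken pointwise
    in x. They are limits of Riemann sums, uniformly in x
    ([riemann_sum_uniform]), and therefore remain in the space of continuous
    functions and commute with bounded linear functionals
    ([functional_integral]): with evaluation of S(h) at a point, which yields
    the semigroup identities, and with integration over Omega, which takes the
    place of Fubini's theorem. *)

(** * Borel sets and Lebesgue measure on R^n *)

Section euclidean_measure.
Context (R : realType).

Lemma measurable_rV_ball n (x : 'rV[R]_n) (e : R) :
  measurable (ball x e : set 'rV[R]_n).
Proof.
have [e0|e0] := leP e 0.
  rewrite (_ : ball x e = set0)//.
  by apply/seteqP; split => // y [/lt_geF]; rewrite e0.
rewrite (_ : ball x e =
    \bigcap_(i in [set: 'I_n]) ((fun y : 'rV[R]_n => y 0 i) @^-1` ball (x 0 i) e)).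
  apply: fin_bigcap_measurable; first exact: finite_finset.
  move=> i _; rewrite -[X in measurable X]setTI.
  by apply: measurable_rV_coord => //; rewrite ball_itv; exact: measurable_itv.
apply/seteqP; split=> [y [_ xy] i _|y xy]; first exact: xy.
by split=> // i j; rewrite ord1; exact: xy.
Qed.

(** The balls with rational centre and radius 1/(k+1) that an open set contains
    cover it, and they are countably many. *)
Lemma open_measurable_rV n (A : set 'rV[R]_n) : open A -> measurable A.
Proof.
move=> oA.
pose B (p : 'rV[rat]_n * nat) : set 'rV[R]_n :=
  if `[< ball (map_mx ratr p.1 : 'rV[R]_n) p.2.+1%:R^-1 `<=` A >]
  then ball (map_mx ratr p.1 : 'rV[R]_n) p.2.+1%:R^-1 else set0.
rewrite (_ : A = \bigcup_(p in [set: 'rV[rat]_n * nat]) B p).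
  apply: countable_bigcupT_measurable => // p.
  by rewrite /B; case: ifP => // _; exact: measurable_rV_ball.
apply/seteqP; split=> [x Ax|x [p _]]; last first.
  by rewrite /B; case: ifPn => // /asboolP; apply.
have /nbhs_ballP[e /= e0 xeA] : nbhs x A by exact: open_nbhs_nbhs.
(* With a radius below e/2, the ball around a rational approximation of x
   contains x and stays in the ball of radius e around x. *)
have [k ke] : exists k : nat, k.+1%:R^-1 < e / 2.
  near \oo => k; exists k; near: k.
  by apply: (near_infty_natSinv_lt (PosNum (_ : 0 < e / 2))); rewrite divr_gt0.
have /choice[q qx] : forall i : 'I_n, exists q : rat, `|x 0 i - ratr q| < k.+1%:R^-1.
  move=> i.
  have /rat_in_itvoo[q] : x 0 i - k.+1%:R^-1 < x 0 i + k.+1%:R^-1.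
    by rewrite ltrBlDr -addrA ltrDl addr_gt0// invr_gt0.
  rewrite in_itv/= => /andP[q1 q2]; exists q.
  by rewrite ltr_norml ltrBrDr ltrBlDr [- _ + _]addrC ltrBlDr q2 -ltrBlDl.
exists (\row_i q i, k) => //; rewrite /B/=; case: ifPn => [_|/asboolP].
  split=> // i j; rewrite ord1 !mxE /ball/= distrC; exact: qx.
case=> y [_ qy]; apply: xeA; split=> // i j; rewrite ord1.
have := qy 0 j; rewrite !mxE /ball/= => h.
rewrite (le_lt_trans (ler_distD (ratr (q j)) _ _))//.
by rewrite (splitr e) ltrD// (lt_trans _ ke).
Unshelve. all: by end_near. Qed.

Lemma continuous_measurable_rV n (A : set 'rV[R]_n) (u : 'rV[R]_n -> R) :
  open A -> {within A, continuous u} -> measurable_fun A u.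
Proof.
move=> oA cu mA.
apply: (measurability _ (RGenOpens.measurableE R)) => //.
move=> _ [_ [a [b ->] <-]]; apply: open_measurable_rV.
move: cu; rewrite continuous_open_subspace// => cu.
have /(_ `]a, b[%classic) := (continuous_inP u oA).1 cu.
by apply; exact: interval_open.
Qed.

Definition cube n (M : R) : set 'rV[R]_n := [set x | forall i, `|x 0 i| <= M].

Lemma measurable_cube n M : measurable (@cube n M).
Proof.
rewrite (_ : cube M = \bigcap_(i in [set: 'I_n])
    ((fun y : 'rV[R]_n => y 0 i) @^-1` `[- M, M]%classic)).
  apply: fin_bigcap_measurable; first exact: finite_finset.
  move=> i _; rewrite -[X in measurable X]setTI.
  by apply: measurable_rV_coord => //; exact: measurable_itv.
apply/seteqP; split=> [y /= h i _|y h i].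
  by rewrite /= in_itv/= -ler_norml.
by have := h i I; rewrite /= in_itv/= -ler_norml.
Qed.

(** By induction on the dimension: up to the identification [rV_cons], a cube is
    the product of an interval and a cube of one dimension less. *)
Lemma lebesgue_rV_cube_fin n M : (lebesgue_rV R n (cube M) < +oo)%E.
Proof.
elim: n => [|n IH].
  by rewrite /= diracE ltry.
rewrite /= /lebesgue_rV_step /pushforward.
rewrite (_ : _ @^-1` _ = `[- M, M]%classic `*`
    (cube M : set 'rV[R]_n)); last first.
  apply/seteqP; split=> [[a x] /= h|[a x] [/= aM xM] i].
    split=> /=; first by have := h ord0; rewrite mxE unlift_none/= in_itv/= ler_norml.
    by move=> i; have := h (lift ord0 i); rewrite mxE liftK.
  rewrite mxE; case: unliftP => [j _|_] /=; first exact: xM.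
  by rewrite ler_norml; move: aM; rewrite in_itv.
rewrite product_measure1E//; last exact: measurable_cube.
apply: lte_mul_pinfty => //; rewrite ge0_fin_numE//.
have : (@lebesgue_measure R [set` `[(- M)%R, M]] < +oo)%E.
  by rewrite lebesgue_measure_itv/=; case: ifP => _; rewrite ?ltry.
by [].
Qed.

Lemma bounded_lebesgue_rV_fin n (A : set 'rV[R]_n) :
  measurable A -> bounded_set A -> (lebesgue_rV R n A < +oo)%E.
Proof.
move=> mA [M [_ AM]].
apply: le_lt_trans (lebesgue_rV_cube_fin n (M + 1)); apply: le_measure;
  rewrite ?inE//; first exact: measurable_cube.
move=> x Ax i; apply: le_trans (AM (M + 1) _ x Ax); last by rewrite ltrDl.
rewrite [leRHS]/Num.norm/= mx_normrE.
by rewrite (le_bigmax _ (fun ij => `|x ij.1 ij.2|) (0, i)).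
Qed.

End euclidean_measure.

(** * Riemann sums and integrals on the line *)

Section riemann_sums.
Context (R : realType).
Implicit Types (phi : R -> R) (D : set R).
Notation mu := (@lebesgue_measure R).

Definition unif_continuous_on D phi : Prop :=
  forall e, 0 < e -> exists2 delta, 0 < delta & forall s s', D s -> D s' ->
    `|s - s'| <= delta -> `|phi s - phi s'| <= e.

Lemma unif_continuous_on_within D phi :
  unif_continuous_on D phi -> {within D, continuous phi}.
Proof.
move=> ucphi; apply/subspace_continuousP => s Ds.
apply/cvgrPdist_le => e e0; have [delta delta0 h] := ucphi _ e0.
rewrite near_withinE; apply/nbhs_ballP; exists delta => // s' /ltW ss' Ds'.
exact: h.
Qed.

Lemma unif_continuous_on_integrable a b phi :
  unif_continuous_on `[a, b] phi -> mu.-integrable `[a, b] (EFin \o phi).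
Proof.
move=> /unif_continuous_on_within ucphi.
by apply: continuous_compact_integrable => //; exact: segment_compact.
Qed.

(** The Heine-Cantor theorem. Compactness is used in the form of a near-covering:
    around each s a radius delta works for all points close to s, so that a
    single delta works on the whole interval. *)
Lemma within_unif_continuous_on a b phi :
  {within `[a, b], continuous phi} -> unif_continuous_on `[a, b] phi.
Proof.
move=> /subspace_continuousP cphi e e0.
have e20 : 0 < e / 2 by rewrite divr_gt0.
have /compact_near_coveringP := @segment_compact _ a b.
move=> /(_ R (0 : R)^'+ (fun delta s => `[a, b]%classic s ->
  forall s', `[a, b]%classic s' -> `|s - s'| <= delta -> `|phi s - phi s'| <= e)).
case.
  move=> s Ds; have /cvgrPdist_le/(_ _ e20) := cphi s Ds.
  rewrite near_withinE => /nbhs_ballP[r /= r0 hr].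
  exists (ball s (r / 2), [set delta | 0 < delta < r / 2]).
    split => /=; first by apply: nbhsx_ballx; rewrite divr_gt0.
    near=> delta; apply/andP; split=> //.
    near: delta; apply: nbhs_right_lt; by rewrite divr_gt0.
  move=> [s1 delta]/= [ss1 /andP[_ dr]] Ds1 s2 Ds2 s12.
  have h1 := hr s1 _ Ds1; have h2 := hr s2 _ Ds2.
  rewrite (le_trans (ler_distD (phi s) _ _))// (splitr e) lerD//.
    by rewrite distrC h1//; apply: lt_le_trans ss1 _; lra.
  apply: h2; rewrite /ball/= (le_lt_trans (ler_distD s1 _ _))// (splitr r) ltrD//.
  exact: le_lt_trans dr.
move=> r /= r0 H.
exists (r / 2); first by rewrite divr_gt0.
move=> s s' Ds Ds' ss'; apply: (H (r / 2) _ _ s) => //=.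
  by rewrite sub0r normrN gtr0_norm ?divr_gt0// ltr_pdivrMr// ltr_pMr// ltr1n.
by rewrite divr_gt0.
Unshelve. all: by end_near. Qed.

(** On each of the n cells of length h, [phi] differs from its value at the left
    endpoint by at most e. *)
Lemma riemann_sum_dist phi a h e n : 0 <= h ->
  mu.-integrable `[a, a + n%:R * h] (EFin \o phi) ->
  (forall s s', `[a, a + n%:R * h]%classic s -> `[a, a + n%:R * h]%classic s' ->
     `|s - s'| <= h -> `|phi s - phi s'| <= e) ->
  `|\int[mu]_(s in `[a, a + n%:R * h]) phi s - \sum_(k < n) h * phi (a + k%:R * h)|
    <= n%:R * h * e.
Proof.
move=> h0; elim: n => [|n IH] iphi osc.
  by rewrite mul0r addr0 set_itv1 Rintegral_set1 big_ord0 !mul0r subrr normr0.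
set x := a + n%:R * h; set b := a + n.+1%:R * h.
have bx : b - x = h by rewrite /b /x -addn1 natrD; ring.
have xb : x <= b by rewrite -subr_ge0 bx.
have ax : a <= x by rewrite lerDl mulr_ge0.
have sub1 : `[a, x]%classic `<=` `[a, b]%classic.
  by move=> s /=; rewrite !in_itv/= => /andP[-> /le_trans->].
have sub2 : `]x, b]%classic `<=` `[a, b]%classic.
  by move=> s /=; rewrite !in_itv/= => /andP[/ltW/(le_trans ax)-> ->].
have i1 : mu.-integrable `[a, x] (EFin \o phi) by exact: integrableS iphi.
have i2 : mu.-integrable `]x, b] (EFin \o phi) by exact: integrableS iphi.
have mxb : mu `]x, b]%classic = h%:E.
  rewrite lebesgue_measure_itv/= lte_fin -EFinB bx; case: ltP => // bx0.
  by congr EFin; apply/eqP; rewrite eq_le h0 -bx subr_le0.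
have icst c : mu.-integrable `]x, b] (EFin \o fun=> c : R).
  apply: measurable_bounded_integrable => //.
    by move: (ltry h); rewrite -mxb.
  exact: bounded_cst.
have intcst c : \int[mu]_(s in `]x, b]) c = h * c.
  by rewrite Rintegral_cst// mulrC; congr (_ * _); move: mxb => /= ->.
have iB : mu.-integrable `]x, b] (EFin \o (fun s => phi s - phi x)).
  exact: (integrableB _ i2 (icst (phi x))).
have {}IH : `|\int[mu]_(s in `[a, x]) phi s
   - \sum_(k < n) h * phi (a + k%:R * h)| <= n%:R * h * e.
  by apply: IH => // s s' /sub1 Ds /sub1 Ds'; exact: osc.
have last : `|\int[mu]_(s in `]x, b]) phi s - h * phi x| <= h * e.
  rewrite -(intcst (phi x)).
  rewrite -RintegralB//; apply: le_trans (le_normr_Rintegral _ _) _ => //.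
  rewrite -(intcst e).
  apply: le_Rintegral => //.
    exact: (integrable_norm iB).
  move=> s sxb; apply: osc; [exact: sub2| |].
    by rewrite /= in_itv/= ax xb.
  move: sxb; rewrite /= in_itv/= => /andP[/ltW xs sb].
  by rewrite ger0_norm ?subr_ge0// -bx lerD2r.
rewrite big_ord_recr/= -/x.
have <- : \int[mu]_(s in `[a, x]) phi s + \int[mu]_(s in `]x, b]) phi s
   = \int[mu]_(s in `[a, b]) phi s.
  by rewrite -(@Rintegral_itvB _ phi (BLeft a) (BRight b) x)// subrKC.
rewrite opprD addrACA (le_trans (ler_normD _ _))//.
by rewrite -addn1 natrD !mulrDl mul1r lerD.
Qed.

End riemann_sums.

Section riemann_mesh.
Context (R : realType).
Notation mu := (@lebesgue_measure R).

Definition riemann_sum (phi : R -> R) a t n : R :=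
  \sum_(k < n) t / n%:R * phi (a + k%:R * (t / n%:R)).

Lemma riemann_node_in (a t : R) n (k : 'I_n) : 0 < t ->
  `[a, a + t]%classic (a + k%:R * (t / n%:R)).
Proof.
move=> t0; rewrite /= in_itv/= lerDl lerD2l; apply/andP; split.
  by rewrite mulr_ge0// divr_ge0// ltW.
have n0 : (0 < n)%N by apply: leq_ltn_trans (ltn_ord k).
rewrite mulrCA ger_pMr// ler_pdivrMr ?ltr0n// mul1r ler_nat.
exact: ltnW (ltn_ord k).
Qed.

Lemma riemann_sum_close phi a t e delta n : 0 < t -> (0 < n)%N ->
  t / n%:R <= delta -> mu.-integrable `[a, a + t] (EFin \o phi) ->
  (forall s s', `[a, a + t]%classic s -> `[a, a + t]%classic s' ->
     `|s - s'| <= delta -> `|phi s - phi s'| <= e / t) ->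
  `|\int[mu]_(s in `[a, a + t]) phi s - riemann_sum phi a t n| <= e.
Proof.
move=> t0 n0 td iphi osc.
have tn : n%:R * (t / n%:R) = t by rewrite mulrC divfK// pnatr_eq0 -lt0n.
have := @riemann_sum_dist R phi a (t / n%:R) (e / t) n.
rewrite tn [t * (e / t)]mulrC divfK ?gt_eqF//; apply => //.
  by rewrite divr_ge0// ltW.
by move=> s s' Ds Ds' /le_trans/(_ td); exact: osc.
Qed.

(** One subdivision can serve two functions with different moduli of
    continuity. *)
Lemma riemann_mesh (t d1 d2 : R) : 0 < t -> 0 < d1 -> 0 < d2 ->
  exists n, [/\ (0 < n)%N, t / n%:R <= d1 & t / n%:R <= d2].
Proof.
move=> t0 d10 d20; pose d := Num.min d1 d2.
have d0 : 0 < d by rewrite lt_min d10.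
exists (Num.truncn (t / d)).+1.
have td : t / (Num.truncn (t / d)).+1%:R <= d.
  rewrite ler_pdivrMr ?ltr0Sn// mulrC -ler_pdivrMr//.
  exact/ltW/truncnS_gt.
by split=> //; apply: le_trans td _; rewrite ge_min lexx ?orbT.
Qed.

(** Both sides are limits of the same Riemann sums. *)
Lemma Rintegral_shift phi (a h t : R) : 0 < t ->
  unif_continuous_on `[a + h, a + h + t] phi ->
  \int[mu]_(s in `[a, a + t]) phi (s + h) =
  \int[mu]_(s in `[a + h, a + h + t]) phi s.
Proof.
move=> t0 ucphi.
have shift s : `[a, a + t]%classic s -> `[a + h, a + h + t]%classic (s + h).
  by rewrite /= !in_itv/= addrAC !lerD2r.
have ucphi' : unif_continuous_on `[a, a + t] (fun s => phi (s + h)).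
  move=> e /ucphi[delta delta0 osc]; exists delta => // s s' Ds Ds' ss'.
  by apply: osc; [exact: shift|exact: shift|rewrite opprD addrACA subrr addr0].
apply/eqP; rewrite -subr_eq0 -normr_le0; apply/ler_addgt0Pl => e e0.
rewrite addr0.
have et0 : 0 < e / 2 / t by rewrite !divr_gt0.
have [d1 d10 osc1] := ucphi _ et0; have [d2 d20 osc2] := ucphi' _ et0.
have [n [n0 nd1 nd2]] := riemann_mesh t0 d10 d20.
have := riemann_sum_close t0 n0 nd1 (unif_continuous_on_integrable ucphi) osc1.
have := riemann_sum_close t0 n0 nd2 (unif_continuous_on_integrable ucphi') osc2.
have -> : riemann_sum (fun s => phi (s + h)) a t n = riemann_sum phi (a + h) t n.
  by apply: eq_bigr => k _; rewrite addrAC.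
move=> h1 h2; rewrite (le_trans (ler_distD (riemann_sum phi (a + h) t n) _ _))//.
by rewrite (splitr e) lerD// distrC.
Qed.

End riemann_mesh.

Section Rintegral_more.
Context (R : realType).
Notation mu := (@lebesgue_measure R).
Implicit Types phi : R -> R.

Lemma Rintegral_chasles phi (a b c : R) : a <= b -> b <= c ->
  mu.-integrable `[a, c] (EFin \o phi) ->
  \int[mu]_(s in `[a, b]) phi s + \int[mu]_(s in `[b, c]) phi s =
  \int[mu]_(s in `[a, c]) phi s.
Proof.
move=> ab bc iphi.
have := @Rintegral_itvB _ phi (BLeft a) (BRight c) b iphi.
rewrite !bnd_simp => /(_ ab bc); rewrite Rintegral_itv_obnd_cbnd => [<-|].
  by rewrite addrC subrK.
apply: integrableS iphi => // s /=; rewrite !in_itv/= => /andP[/ltW bs ->].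
by rewrite (le_trans ab).
Qed.

(** The integral over one cell is compared with the Riemann sum of one term. *)
Lemma mean_value_close phi (a h e : R) : 0 < h ->
  mu.-integrable `[a, a + h] (EFin \o phi) ->
  (forall s s', `[a, a + h]%classic s -> `[a, a + h]%classic s' ->
     `|s - s'| <= h -> `|phi s - phi s'| <= e) ->
  `|h^-1 * \int[mu]_(s in `[a, a + h]) phi s - phi a| <= e.
Proof.
move=> h0 iphi osc.
have := @riemann_sum_dist R phi a h e 1 (ltW h0).
rewrite !mul1r big_ord_recl big_ord0 addr0 mul0r addr0 => /(_ iphi osc) close.
have -> : h^-1 * \int[mu]_(s in `[a, a + h]) phi s - phi a =
    h^-1 * (\int[mu]_(s in `[a, a + h]) phi s - h * phi a).
  by rewrite mulrBr mulKf ?gt_eqF.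
by rewrite normrM gtr0_norm ?invr_gt0// ler_pdivrMl.
Qed.

End Rintegral_more.

(** * Continuous functions on the closure of the domain *)

Section continuous_functions.
Context (R : realType) (d : nat) (Omega : set 'rV[R]_d)
  (bc : boundary_condition R d).
Hypotheses (Omega_open : open Omega) (Omega_bounded : bounded_set Omega).
Implicit Types u v : 'rV[R]_d -> R.
Notation mu := (@lebesgue_measure R).
Notation K := (closure Omega).
Notation X := (cspace bc Omega).

Lemma compact_closure : compact K.
Proof using Omega_bounded.
apply: bounded_closed_compact; last exact: closed_closure.
have [M [_ OM]] := Omega_bounded.
exists (M + 1); split; first exact: num_real.
move=> N MN x Kx; apply: le_trans (ltW MN).
have cl : closed [set y : 'rV[R]_d | `|y| <= M + 1].
  rewrite (_ : mkset _ = (fun y : 'rV[R]_d => `|y|) @^-1` [set z | z <= M + 1])//.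
  by apply: preimage_closed; [move=> ? ?; exact: norm_continuous|exact: closed_le].
suff : [set y : 'rV[R]_d | `|y| <= M + 1] x by [].
rewrite ((closure_id _).1 cl); apply: closure_subset Kx => y /= Oy.
by apply: OM; rewrite ?ltrDl.
Qed.

Lemma cspace_bounded u : X u -> exists M, forall x, K x -> `|u x| <= M.
Proof using Omega_bounded.
move=> [cu _]; have := continuous_compact cu compact_closure.
move=> /compact_bounded[M [_ uM]]; exists (M + 1) => x Kx.
by apply: uM; rewrite ?ltrDl//; exists x.
Qed.

Lemma le_supnorm u x : X u -> K x -> `|u x| <= supnorm Omega u.
Proof using Omega_bounded.
move=> /cspace_bounded[M uM] Kx; apply: ub_le_sup; last by exists x.
by exists M => _ [y Ky <-]; exact: uM.
Qed.

(** The hypothesis [0 <= M] covers the empty closure, where [supnorm] is 0. *)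
Lemma supnorm_le u M : 0 <= M -> (forall x, K x -> `|u x| <= M) ->
  supnorm Omega u <= M.
Proof.
move=> M0 uM; rewrite /supnorm; have [->|/set0P[x Kx]] := eqVneq K set0.
  by rewrite image_set0 sup0.
by apply: ge_sup; [exists `|u x|; exists x|move=> _ [y Ky <-]; exact: uM].
Qed.

(** Membership in [cspace] depends on the values on the closure only; this gives
    access to functions that are known up to equality there. *)
Lemma cspace_ext u v : (forall x, K x -> u x = v x) -> X u -> X v.
Proof.
move=> uv [cu pu]; split.
  by apply: subspace_eq_continuous cu => x /set_mem/uv.
  case: bc pu => [//|a b] pu i x y Kx Ky; rewrite -!uv//; exact: pu.
Qed.

Lemma cspace_cst c : X (fun=> c).
Proof. by split; [move=> ?; exact: cst_continuous|case: bc]. Qed.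

Lemma cspace_comp (h : R -> R) u : continuous h -> X u -> X (h \o u).
Proof.
move=> ch [cu pu]; split.
  by move=> x; apply: (@continuous_comp (subspace K) R R u h); [exact: cu|exact: ch].
by case: bc pu => [//|a b] pu i x y Kx Ky; congr h; exact: pu.
Qed.

Lemma cspaceP c u v : X u -> X v -> X (fun x => c * u x + v x).
Proof.
move=> [cu pu] [cv pv]; split.
  move=> x; apply: cvgD; last exact: cv.
  by apply: cvgM; [exact: cvg_cst|exact: cu].
case: bc pu pv => [//|a b] pu pv i x y Kx Ky.
by rewrite (pu i x Kx Ky : u y = u x) (pv i x Kx Ky : v y = v x).
Qed.

Lemma cspaceD u v : X u -> X v -> X (fun x => u x + v x).
Proof.
by move=> Xu /(cspaceP 1 Xu); apply: cspace_ext => x _; rewrite mul1r.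
Qed.

Lemma cspaceZ c u : X u -> X (fun x => c * u x).
Proof.
move=> Xu; have := cspaceP c Xu (cspace_cst 0).
by apply: cspace_ext => x _; rewrite addr0.
Qed.

Lemma cspaceB u v : X u -> X v -> X (fun x => u x - v x).
Proof.
move=> Xu Xv; have := cspaceP (- 1) Xv Xu.
by apply: cspace_ext => x _; rewrite mulN1r addrC.
Qed.

Lemma cspace_sum n (c : 'I_n -> R) (F : 'I_n -> 'rV[R]_d -> R) :
  (forall k, X (F k)) -> X (fun x => \sum_(k < n) c k * F k x).
Proof.
elim: n c F => [|n IH] c F XF.
  by apply: cspace_ext (cspace_cst 0) => x _; rewrite big_ord0.
have := cspaceP (c ord0) (XF ord0)
  (IH (fun k => c (lift ord0 k)) (fun k => F (lift ord0 k)) (fun k => XF _)).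
by apply: cspace_ext => x _; rewrite big_ord_recl.
Qed.

Lemma ler_dist3 (x y x' y' e : R) : `|x - x'| <= e / 3 -> `|y - y'| <= e / 3 ->
  `|x' - y'| <= e / 3 -> `|x - y| <= e.
Proof.
rewrite !ler_norml => /andP[h1 h2] /andP[h3 h4] /andP[h5 h6].
by apply/andP; split; lra.
Qed.

Lemma cspace_uniform_limit u :
  (forall e, 0 < e -> exists2 v, X v & forall x, K x -> `|u x - v x| <= e) ->
  X u.
Proof.
move=> ulim; split.
  apply/subspace_continuousP => x Kx; apply/cvgrPdist_le => e e0.
  have e30 : 0 < e / 3 by rewrite divr_gt0.
  have [v [/subspace_continuousP cv _] uv] := ulim _ e30.
  have /cvgrPdist_le/(_ _ e30) := cv x Kx.
  rewrite !near_withinE; apply: filterS => y vxy Ky.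
  exact: ler_dist3 (uv _ Kx) (uv _ Ky) (vxy Ky).
case: bc ulim => [//|a b] ulim i x y Kx Ky.
apply/eqP; rewrite -subr_eq0 -normr_le0; apply/ler_addgt0Pl => e e0; rewrite addr0.
have e30 : 0 < e / 3 by rewrite divr_gt0.
have [v [_ pv] uv] := ulim _ e30; have vyx : v y = v x := pv i x Kx Ky.
apply: ler_dist3 (uv _ Ky) (uv _ Kx) _.
by rewrite vyx subrr normr0 ltW.
Qed.

Lemma measurable_domain : measurable Omega.
Proof using Omega_open. exact: open_measurable_rV. Qed.

Lemma domain_sub_closure x : Omega x -> K x.
Proof. exact: subset_closure. Qed.

Lemma cspace_integrable u :
  X u -> (lebesgue_rV R d).-integrable Omega (EFin \o u).
Proof using Omega_open Omega_bounded.
move=> Xu; apply: measurable_bounded_integrable.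
- exact: measurable_domain.
- exact: bounded_lebesgue_rV_fin measurable_domain Omega_bounded.
- apply: continuous_measurable_rV => //.
  exact: continuous_subspaceW (@subset_closure _ Omega) Xu.1.
- have [M uM] := cspace_bounded Xu.
  exists M; split; first exact: num_real.
  move=> N /ltW MN x Ox; apply: le_trans MN; apply: uM.
  exact: domain_sub_closure.
Qed.

Lemma eq_integ u v : (forall x, K x -> u x = v x) ->
  integ Omega u = integ Omega v.
Proof.
by move=> uv; apply: eq_Rintegral => x /set_mem/domain_sub_closure/uv.
Qed.

Lemma integP c u v : X u -> X v ->
  integ Omega (fun x => c * u x + v x) = c * integ Omega u + integ Omega v.
Proof using Omega_open Omega_bounded.
move=> Xu Xv; rewrite /integ RintegralD.
- rewrite RintegralZl//; [exact: measurable_domain|exact: cspace_integrable].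
- exact: measurable_domain.
- by apply: (@cspace_integrable (fun x => c * u x)); exact: cspaceZ.
- exact: cspace_integrable.
Qed.

Lemma integB u v : X u -> X v ->
  integ Omega (fun x => u x - v x) = integ Omega u - integ Omega v.
Proof using Omega_open Omega_bounded.
move=> Xu Xv; rewrite addrC -mulN1r -integP//.
by apply: eq_integ => x _; rewrite mulN1r addrC.
Qed.

Lemma le_integ u v : X u -> X v -> (forall x, K x -> u x <= v x) ->
  integ Omega u <= integ Omega v.
Proof using Omega_open Omega_bounded.
move=> Xu Xv uv; apply: le_Rintegral.
- exact: measurable_domain.
- exact: cspace_integrable.
- exact: cspace_integrable.
- by move=> x /domain_sub_closure; exact: uv.
Qed.

Lemma integ_cst c : integ Omega (fun=> c) = c * vol Omega.
Proof using Omega_open.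
by rewrite /integ Rintegral_cst//; exact: measurable_domain.
Qed.

Lemma normr_integ_le u M : X u -> (forall x, K x -> `|u x| <= M) ->
  `|integ Omega u| <= vol Omega * M.
Proof using Omega_open Omega_bounded.
move=> Xu uM; rewrite mulrC ler_norml -mulNr -!integ_cst.
apply/andP; split; apply: le_integ => //; try exact: cspace_cst.
- by move=> x /uM; rewrite ler_norml => /andP[].
- by move=> x /uM; rewrite ler_norml => /andP[].
Qed.

End continuous_functions.

(** * Curves of continuous functions and their integrals *)

Section curves.
Context (R : realType) (d : nat) (Omega : set 'rV[R]_d)
  (bc : boundary_condition R d).
Hypotheses (Omega_open : open Omega) (Omega_bounded : bounded_set Omega).
Implicit Types (u v : 'rV[R]_d -> R) (F G : R -> 'rV[R]_d -> R).
Notation mu := (@lebesgue_measure R).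
Notation K := (closure Omega).
Notation X := (cspace bc Omega).

(** Continuous curves in [cspace] for the supremum norm. The modulus of
    continuity is uniform in the parameter, because Riemann sums need it. *)
Record curve (D : set R) F : Prop := {
  curve_cspace : forall s, D s -> X (F s);
  curve_modulus : forall e : R, 0 < e -> exists2 delta, 0 < delta &
    forall s s', D s -> D s' -> `|s - s'| <= delta ->
    forall x, K x -> `|F s x - F s' x| <= e }.

Lemma curve_eval D F x : curve D F -> K x -> unif_continuous_on D (F ^~ x).
Proof.
move=> cF Kx e e0; have [delta delta0 osc] := curve_modulus cF e0.
by exists delta => // s s' Ds Ds' ss'; exact: osc.
Qed.

Lemma curve_lipschitz_comp D D' F (theta : R -> R) (L : R) : 0 < L ->
  (forall s, D' s -> D (theta s)) ->
  (forall s s', `|theta s - theta s'| <= L * `|s - s'|) ->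
  curve D F -> curve D' (F \o theta).
Proof.
move=> L0 DD' lip [XF osc]; split=> [s /DD'|e /osc[delta d0 h]]; first exact: XF.
exists (delta / L); first exact: divr_gt0.
move=> s s' Ds Ds' ss' x Kx; apply: h => //; try exact: DD'.
by rewrite (le_trans (lip _ _))// mulrC -ler_pdivlMr.
Qed.

Lemma curveD D F G : curve D F -> curve D G -> curve D (fun s x => F s x + G s x).
Proof.
move=> [XF oscF] [XG oscG]; split=> [s Ds|e e0].
  by apply: cspaceD; [exact: XF|exact: XG].
have e20 : 0 < e / 2 by rewrite divr_gt0.
have [d1 d10 h1] := oscF _ e20; have [d2 d20 h2] := oscG _ e20.
exists (Num.min d1 d2); first by rewrite lt_min d10.
move=> s s' Ds Ds'; rewrite le_min => /andP[sd1 sd2] x Kx.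
rewrite opprD addrACA (splitr e) (le_trans (ler_normD _ _))// lerD//.
  exact: h1.
exact: h2.
Qed.

Lemma curveZ D (c : R -> R) F (A B : R) : 0 < A -> 0 < B ->
  unif_continuous_on D c -> (forall s, D s -> `|c s| <= A) ->
  curve D F -> (forall s x, D s -> K x -> `|F s x| <= B) ->
  curve D (fun s x => c s * F s x).
Proof.
move=> A0 B0 ucc cA [XF osc] FB; split=> [s Ds|e e0].
  by apply: cspaceZ; exact: XF.
have e20 : 0 < e / 2 / A by rewrite !divr_gt0.
have e20' : 0 < e / 2 / B by rewrite !divr_gt0.
have [d1 d10 h1] := osc _ e20; have [d2 d20 h2] := ucc _ e20'.
exists (Num.min d1 d2); first by rewrite lt_min d10.
move=> s s' Ds Ds'; rewrite le_min => /andP[sd1 sd2] x Kx.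
have -> : c s * F s x - c s' * F s' x =
  c s * (F s x - F s' x) + (c s - c s') * F s' x by ring.
rewrite (splitr e) (le_trans (ler_normD _ _))// !normrM lerD//.
  rewrite -[leRHS](divfK (lt0r_neq0 A0)) mulrC ler_pM//; [exact: h1|exact: cA].
rewrite -[leRHS](divfK (lt0r_neq0 B0)) ler_pM//; [exact: h2|exact: FB].
Qed.

Section integral.
Variables (a t : R) (F : R -> 'rV[R]_d -> R).
Hypotheses (t0 : 0 < t) (cF : curve `[a, a + t] F).

Definition curve_integral : 'rV[R]_d -> R :=
  fun x => \int[mu]_(s in `[a, a + t]) F s x.

Lemma cspace_riemann_sum n : X (fun x => riemann_sum (F ^~ x) a t n).
Proof.
rewrite /riemann_sum.
apply: (@cspace_sum _ _ _ _ n (fun=> t / n%:R)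
  (fun k => F (a + k%:R * (t / n%:R)))) => k.
exact/(curve_cspace cF)/riemann_node_in.
Qed.

(** The modulus of a curve does not depend on x, hence neither does the error of
    its Riemann sums. *)
Lemma riemann_sum_uniform e : 0 < e -> exists2 delta, 0 < delta &
  forall n, (0 < n)%N -> t / n%:R <= delta ->
  forall x, K x -> `|curve_integral x - riemann_sum (F ^~ x) a t n| <= e.
Proof.
move=> e0; have et0 : 0 < e / t by rewrite divr_gt0.
have [delta d0 osc] := curve_modulus cF et0; exists delta => // n n0 nd x Kx.
apply: riemann_sum_close nd _ _ => //.
  exact: unif_continuous_on_integrable (curve_eval cF Kx).
by move=> s s' Ds Ds' ss'; exact: osc.
Qed.

Lemma cspace_integral : X curve_integral.
Proof.
apply: cspace_uniform_limit => e /riemann_sum_uniform[delta d0 close].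
have [n [n0 nd _]] := riemann_mesh t0 d0 d0.
exists (fun x => riemann_sum (F ^~ x) a t n); first exact: cspace_riemann_sum.
exact: close.
Qed.

Variables (ell : ('rV[R]_d -> R) -> R) (C : R).
Hypotheses (C0 : 0 <= C)
  (ell_linear : forall c u v, X u -> X v ->
     ell (fun x => c * u x + v x) = c * ell u + ell v)
  (ell_bounded : forall u M, X u -> (forall x, K x -> `|u x| <= M) ->
     `|ell u| <= C * M).

Let ell0 : ell (fun=> 0) = 0.
Proof.
apply/eqP; rewrite -normr_le0 -[leRHS](mulr0 C); apply: ell_bounded.
  exact: cspace_cst.
by move=> x _; rewrite normr0.
Qed.

Let ellB u v : X u -> X v -> ell (fun x => u x - v x) = ell u - ell v.
Proof.
move=> Xu Xv; rewrite addrC -mulN1r -ell_linear//; congr ell.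
by apply/funext => x; rewrite mulN1r addrC.
Qed.

Let ell_sum n (c : 'I_n -> R) (G : 'I_n -> 'rV[R]_d -> R) :
  (forall k, X (G k)) ->
  ell (fun x => \sum_(k < n) c k * G k x) = \sum_(k < n) c k * ell (G k).
Proof.
elim: n c G => [|n IH] c G XG.
  by rewrite big_ord0 -[RHS]ell0; congr ell; apply/funext => x; rewrite big_ord0.
rewrite big_ord_recl -IH// -ell_linear//; last exact: cspace_sum.
by congr ell; apply/funext => x; rewrite big_ord_recl.
Qed.

Lemma functional_unif_continuous : unif_continuous_on `[a, a + t] (ell \o F).
Proof.
move=> e e0; have eC0 : 0 < e / (C + 1) by rewrite divr_gt0// ltr_wpDl.
have [delta d0 osc] := curve_modulus cF eC0; exists delta => // s s' Ds Ds' ss'.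
have XF := curve_cspace cF.
rewrite /= -ellB; [|exact: XF|exact: XF].
apply: le_trans (ell_bounded (cspaceB (XF _ Ds) (XF _ Ds')) (osc _ _ Ds Ds' ss')) _.
rewrite mulrCA ger_pMr// ler_pdivrMr ?ltr_wpDl// mul1r; lra.
Qed.

(** Linearity makes [ell] commute with Riemann sums; the bound on [ell] and the
    uniform convergence of the Riemann sums carry this over to the integral. *)
Lemma functional_integral :
  ell curve_integral = \int[mu]_(s in `[a, a + t]) ell (F s).
Proof.
apply/eqP; rewrite -subr_eq0 -normr_le0; apply/ler_addgt0Pl => e e0.
rewrite addr0.
have e20 : 0 < e / 2 by rewrite divr_gt0.
have eC0 : 0 < e / 2 / (C + 1) by rewrite divr_gt0// ltr_wpDl.
have et0 : 0 < e / 2 / t by rewrite divr_gt0.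
have [d1 d10 close] := riemann_sum_uniform eC0.
have [d2 d20 osc] := functional_unif_continuous et0.
(* The same subdivision approximates the integral of the curve and that of its
   image under [ell]. *)
have [n [n0 nd1 nd2]] := riemann_mesh t0 d10 d20.
have := riemann_sum_close t0 n0 nd2
  (unif_continuous_on_integrable functional_unif_continuous) osc.
have ellr : ell (fun x => riemann_sum (F ^~ x) a t n) = riemann_sum (ell \o F) a t n.
  rewrite /riemann_sum
    (@ell_sum n (fun=> t / n%:R) (fun k => F (a + k%:R * (t / n%:R))))// => k.
  exact/(curve_cspace cF)/riemann_node_in.
have := ell_bounded (cspaceB cspace_integral (cspace_riemann_sum n)) (close n n0 nd1).
rewrite ellB; [|exact: cspace_integral|exact: cspace_riemann_sum].
rewrite ellr => h1 h2.
rewrite (le_trans (ler_distD (riemann_sum (ell \o F) a t n) _ _))//.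
rewrite (splitr e) lerD//; last by rewrite distrC.
apply: le_trans h1 _.
rewrite mulrCA ger_pMr// ler_pdivrMr ?ltr_wpDl// mul1r; lra.
Qed.

End integral.

End curves.

(** * Mass conservation by the heat semigroup *)

Section semigroup.
Context (R : realType) (d : nat) (Omega : set 'rV[R]_d)
  (bc : boundary_condition R d).
Hypotheses (Omega_open : open Omega) (Omega_bounded : bounded_set Omega).
Variable S : R -> ('rV[R]_d -> R) -> 'rV[R]_d -> R.
Hypothesis HS : laplacian_semigroup bc Omega S.
Implicit Types u v : 'rV[R]_d -> R.
Notation mu := (@lebesgue_measure R).
Notation K := (closure Omega).
Notation X := (cspace bc Omega).

Lemma supnorm_ge0 u : 0 <= supnorm Omega u.
Proof.
rewrite /supnorm; set A := (X in sup X).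
have [supA|/sup_out->//] := pselect (has_sup A).
have [_ [x Kx _]] := supA.1.
by apply: le_trans (normr_ge0 (u x)) (ub_le_sup supA.2 _); exists x.
Qed.

Lemma semigroup_le t u M x : 0 <= t -> X u -> (forall y, K y -> `|u y| <= M) ->
  K x -> `|S t u x| <= M.
Proof.
move=> t0 Xu uM Kx; have M0 : 0 <= M by apply: le_trans (uM x Kx).
apply: le_trans (le_supnorm Omega_bounded (semigroup_cspace HS t0 Xu) Kx) _.
exact: le_trans (semigroup_contraction HS t0 Xu) (supnorm_le M0 uM).
Qed.

Lemma semigroup_dist t u v M x : 0 <= t -> X u -> X v ->
  (forall y, K y -> `|u y - v y| <= M) -> K x -> `|S t u x - S t v x| <= M.
Proof.
move=> t0 Xu Xv uvM Kx.
have -> : S t u x - S t v x = S t (fun y => (- 1) * v y + u y) x.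
  by rewrite (semigroup_linear HS)// mulN1r addrC.
apply: semigroup_le => //; first exact: cspaceP.
by move=> y Ky; rewrite mulN1r addrC; exact: uvM.
Qed.

Lemma semigroup_near0 u e : X u -> 0 < e -> exists2 delta, 0 < delta &
  forall h, 0 <= h -> h <= delta -> forall x, K x -> `|S h u x - u x| <= e.
Proof.
move=> Xu e0; have /cvgrPdist_le/(_ _ e0) := semigroup_continuous HS Xu.
rewrite near_withinE => /nbhs_ballP[r /= r0 near0].
exists (r / 2); first by rewrite divr_gt0.
move=> h; rewrite le_eqVlt => /predU1P[<- _ x Kx|h0 hr x Kx].
  by rewrite (semigroup0 HS)// subrr normr0 ltW.
have Xh : X (fun x => S h u x - u x).
  by apply: cspaceB => //; apply: (semigroup_cspace HS) => //; exact: ltW.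
apply: le_trans (le_supnorm Omega_bounded Xh Kx) _.
apply: le_trans (near0 h _ h0); first by rewrite sub0r normrN ler_norm.
rewrite /ball/= sub0r normrN gtr0_norm// (le_lt_trans hr)//.
by rewrite ltr_pdivrMr// ltr_pMr// ltr1n.
Qed.

(** By the semigroup law and contractivity, S(s') u - S(s) u is no larger than
    S(s' - s) u - u for s <= s', so continuity at 0 gives a modulus for the whole
    orbit. *)
Lemma semigroup_curve a b u : 0 <= a -> X u -> curve Omega bc `[a, b] (S ^~ u).
Proof.
move=> a0 Xu; split=> [s|e e0].
  by rewrite /= in_itv/= => /andP[/(le_trans a0) s0 _]; exact: (semigroup_cspace HS).
have [delta d0 near0] := semigroup_near0 Xu e0; exists delta => // s s'.
rewrite /= !in_itv/= => /andP[/(le_trans a0) s0 _] /andP[/(le_trans a0) s'0 _].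
wlog ss' : s s' s0 s'0 / s <= s' => [hwlog ds x Kx|].
  have [ss'|/ltW ss'] := leP s s'; first exact: hwlog.
  by rewrite distrC; apply: hwlog => //; rewrite distrC.
rewrite distrC ger0_norm ?subr_ge0// => dss' x Kx.
have h0 : 0 <= s' - s by rewrite subr_ge0.
rewrite distrC -[in S s' _ _](subrKC s s') (semigroupD HS)//.
apply: semigroup_dist => //; first exact: (semigroup_cspace HS).
by move=> y Ky; exact: near0.
Qed.

Section orbit_integral.
Variables (t : R) (u : 'rV[R]_d -> R).
Hypotheses (t0 : 0 < t) (Xu : X u).

Let U := curve_integral 0 t (S ^~ u).

Let phi_int x a b : K x -> 0 <= a ->
  mu.-integrable `[a, b] (EFin \o (fun s => S s u x)).
Proof.
move=> Kx a0; apply: unif_continuous_on_integrable.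
exact: (curve_eval (semigroup_curve b a0 Xu)).
Qed.

Lemma cspace_orbit_integral : X U.
Proof. exact: cspace_integral t0 (semigroup_curve _ (lexx 0) Xu). Qed.

(** S(h) commutes with the integral, one point x at a time: v |-> S(h) v x is a
    functional of norm at most 1. *)
Lemma semigroup_orbit_integral h x : 0 <= h -> K x ->
  S h U x = \int[mu]_(s in `[h, h + t]) S s u x.
Proof.
move=> h0 Kx.
have cS := semigroup_curve (0 + t) (lexx 0) Xu.
rewrite (functional_integral t0 cS (ell := fun v => S h v x) (C := 1))//.
- transitivity (\int[mu]_(s in `[0, 0 + t]) S (s + h) u x).
    apply: eq_Rintegral => s; rewrite inE/= in_itv/= => /andP[s0 _].
    by rewrite addrC (semigroupD HS).
  rewrite (@Rintegral_shift _ (fun s => S s u x) 0 h t)// add0r//.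
  exact: (curve_eval (semigroup_curve _ h0 Xu)).
- by move=> c v w Xv Xw; exact: (semigroup_linear HS).
- by move=> v M Xv vM; rewrite mul1r; exact: semigroup_le.
Qed.

(** S(h) U is the integral of the orbit over [h, h + t]. Subtracting U, the part
    over [h, t] cancels, and
      (S(h) U - U) / h = (1/h) \int_t^{t+h} S(s) u ds - (1/h) \int_0^h S(s) u ds,
    a difference of averages that converge to S(t) u and u, uniformly in x. *)
Lemma generator_orbit_integral : laplacian bc Omega U (fun x => S t u x - u x).
Proof.
have XU := cspace_orbit_integral.
have Xv : X (fun x => S t u x - u x).
  by apply: cspaceB => //; apply: (semigroup_cspace HS) => //; exact: ltW.
apply/(semigroup_generator HS XU Xv)/cvgrPdist_le => e e0.
have e20 : 0 < e / 2 by rewrite divr_gt0.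
have [delta d0 osc] := curve_modulus (semigroup_curve (t + 1) (lexx 0) Xu) e20.
near=> h.
have h0 : 0 < h by [].
have hd : h <= delta by near: h; exact: nbhs_right_le.
have h1 : h <= 1 by near: h; exact: nbhs_right_le.
rewrite sub0r normrN ger0_norm ?supnorm_ge0//; apply: supnorm_le; first exact: ltW.
move=> x Kx.
have mean a : 0 <= a -> a <= t ->
    `|h^-1 * \int[mu]_(s in `[a, a + h]) S s u x - S a u x| <= e / 2.
  move=> a0 a_t; apply: (@mean_value_close _ (fun s => S s u x)) => //.
    exact: phi_int.
  have sub s : `[a, a + h]%classic s -> `[0, t + 1]%classic s.
    rewrite /= !in_itv/= => /andP[/(le_trans a0)-> sa]/=.
    by rewrite (le_trans sa)// lerD.
  by move=> s s' /sub Ds /sub Ds' /le_trans/(_ hd) ss'; exact: osc.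
have chasles : \int[mu]_(s in `[h, h + t]) S s u x - U x =
    \int[mu]_(s in `[t, t + h]) S s u x - \int[mu]_(s in `[0, 0 + h]) S s u x.
  apply/eqP; rewrite subr_eq addrAC -subr_eq opprK; apply/eqP.
  rewrite /U /curve_integral !add0r [LHS]addrC [RHS]addrC.
  rewrite !Rintegral_chasles ?(addrC h)//; do ?[exact: phi_int|exact: ltW|
    by rewrite lerDl ltW|by rewrite lerDr ltW].
have := mean t (ltW t0) (lexx t); have := mean 0 (lexx 0) (ltW t0).
rewrite (semigroup0 HS)// (semigroup_orbit_integral (ltW h0) Kx) chasles mulrBr => m1 m2.
set A := h^-1 * _ in m2 *; set B := h^-1 * _ in m1 *.
have -> : A - B - (S t u x - u x) = (A - S t u x) - (B - u x) by ring.
by rewrite (splitr e) (le_trans (ler_normB _ _))// lerD.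
Unshelve. all: by end_near. Qed.

End orbit_integral.

Lemma smooth_cst (c : R) : smooth (fun _ : 'rV[R]_d => c).
Proof.
move=> s x.
have [c' ->] : exists c', foldr (@partial R d) (fun=> c) s = fun=> c'.
  elim: s => [|i s [c' IH]]; first by exists c.
  by exists 0; rewrite /= IH; apply/funext => y; rewrite /partial derive_cst.
exact: differentiable_cst.
Qed.

(** The constant 1 is smooth and periodic, hence admissible as a test function
    for both boundary conditions, and its gradient vanishes. *)
Lemma integ_laplacian u v : laplacian bc Omega u v -> integ Omega v = 0.
Proof.
case=> _ _ [p [_ _ green]].
have := green (fun=> 1) (smooth_cst 1).
have -> : (fun x => v x * 1) = v by apply/funext => x; rewrite mulr1.
have -> : (fun x => \sum_(i < d) p i x * partial i (fun=> 1) x) = fun=> 0.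
  apply/funext => x; rewrite big1// => i _.
  by rewrite /partial derive_cst mulr0.
have -> : integ Omega (fun=> 0) = 0 by rewrite integ_cst// mul0r.
have periodic1 : periodic_on setT bc (fun=> 1) by case: bc.
by move=> /(_ periodic1)/esym/eqP; rewrite oppr_eq0 => /eqP.
Qed.

Lemma integ_semigroup t u : 0 <= t -> X u -> integ Omega (S t u) = integ Omega u.
Proof.
rewrite le_eqVlt => /predU1P[<- Xu|t0 Xu].
  by apply: eq_integ => x Kx; rewrite (semigroup0 HS).
have XS : X (S t u) by apply: (semigroup_cspace HS) => //; exact: ltW.
apply/eqP; rewrite -subr_eq0 -(integB _ _ XS Xu)//.
exact/eqP/(integ_laplacian (generator_orbit_integral t0 Xu)).
Qed.

End semigroup.

(** * The nonlinearity and the exponential kernel *)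

Section nonlinearity.
Context (R : realType).
Implicit Types s l kappa : R.

(** Because f(s) = s g(s). *)
Lemma normr_f_le_g s : `|s| <= 1 -> `|f s| <= g s.
Proof.
rewrite !ler_norml /f /g => /andP[s1 s2].
(* These products are g s + f s and g s - f s. *)
have lower : 0 <= (1 - s) * (1 + s) ^+ 2.
  by rewrite mulr_ge0 ?sqr_ge0// subr_ge0.
have upper : 0 <= (1 + s) * (1 - s) ^+ 2.
  by rewrite mulr_ge0 ?sqr_ge0// -lerBlDl sub0r.
by apply/andP; split; lra.
Qed.

Lemma continuous_f : continuous (@f R).
Proof.
by move=> s; apply: cvgB; [exact: cvg_id|exact: exprn_continuous].
Qed.

Lemma continuous_g : continuous (@g R).
Proof.
by move=> s; apply: cvgB; [exact: cvg_cst|exact: exprn_continuous].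
Qed.

(** As g(s) = (1 - s)(1 + s) and f(s) = s g(s), the distances from
    kappa s + (s - l) g(s) to kappa and to - kappa factor through 1 - s and 1 + s,
    and the other factors are nonnegative because |s - l| and |1 +- s| are at most 2. *)
Lemma normr_nonlin_le s l kappa : 4 <= kappa -> `|s| <= 1 -> `|l| <= 1 ->
  `|kappa * s + f s - l * g s| <= kappa.
Proof.
move=> k4; rewrite !ler_norml /f /g => /andP[s1 s2] /andP[l1 l2].
have upper : 0 <= (1 - s) * (kappa - (s - l) * (1 + s)).
  by apply: mulr_ge0; nra.
have lower : 0 <= (1 + s) * (kappa + (s - l) * (1 - s)).
  by apply: mulr_ge0; nra.
by apply/andP; split; nra.
Qed.

Lemma continuous_decay kappa tau :
  continuous (fun s => expR (- kappa * (tau - s))).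
Proof.
move=> s; apply: (@continuous_comp _ _ _ (fun s => - kappa * (tau - s)) expR).
  by apply: cvgM; [exact: cvg_cst|apply: cvgB; [exact: cvg_cst|exact: cvg_id]].
exact: continuous_expR.
Qed.

Lemma Rintegral_expR_kernel kappa tau : 0 < tau ->
  \int[@lebesgue_measure R]_(s in `[0, tau]) (kappa * expR (- kappa * (tau - s))) =
  1 - expR (- kappa * tau).
Proof.
move=> tau0.
have dF s : is_derive s 1 (fun s => expR (- kappa * (tau - s)))
    (kappa * expR (- kappa * (tau - s))).
  have dG : is_derive s 1 (fun s => - kappa * (tau - s)) kappa.
    by apply: is_derive_eq; rewrite /GRing.scale/=; ring.
  rewrite mulrC.
  exact: (@is_derive1_comp _ expR (fun s => - kappa * (tau - s)) s _ _
    (is_derive_expR _) dG).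
rewrite /Rintegral (@continuous_FTC2 _ _ (fun s => expR (- kappa * (tau - s))))//=.
- by rewrite subrr mulr0 expR0 subr0.
- apply: continuous_subspaceT => s.
  by apply: cvgM; [exact: cvg_cst|exact: continuous_decay].
- split.
  + by move=> s _; case: (dF s).
  + apply: cvg_at_right_filter; exact: continuous_decay.
  + apply: cvg_at_left_filter; exact: continuous_decay.
- by move=> s _; rewrite derive1E; case: (dF s).
Qed.

End nonlinearity.

(** * Invariance of mass and maximum bound under the scheme *)

Section scheme.
Context (R : realType) (d : nat) (Omega : set 'rV[R]_d)
  (bc : boundary_condition R d).
Hypotheses (Omega_open : open Omega) (Omega_bounded : bounded_set Omega).
Variable S : R -> ('rV[R]_d -> R) -> 'rV[R]_d -> R.
Hypothesis HS : laplacian_semigroup bc Omega S.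
Variables eps kappa tau : R.
Hypotheses (eps_gt0 : 0 < eps) (kappa_ge4 : 4 <= kappa) (tau_gt0 : 0 < tau).
Implicit Types u v a b : 'rV[R]_d -> R.
Notation mu := (@lebesgue_measure R).
Notation K := (closure Omega).
Notation X := (cspace bc Omega).
Notation N := (nonlin Omega kappa).

Section nonlinear_term.
Variable u : 'rV[R]_d -> R.
Hypotheses (Xu : X u) (u1 : forall x, K x -> `|u x| <= 1).

Let Xf : X (fun x => f (u x)).
Proof. exact: cspace_comp (@continuous_f R) Xu. Qed.

Let Xg : X (fun x => g (u x)).
Proof. exact: cspace_comp (@continuous_g R) Xu. Qed.

Let integ_f_le_g :
  `|integ Omega (fun x => f (u x))| <= integ Omega (fun x => g (u x)).
Proof.
have fg x : K x -> - g (u x) <= f (u x) <= g (u x).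
  by move=> /u1/normr_f_le_g; rewrite ler_norml.
rewrite ler_norml; apply/andP; split; last first.
  by apply: (le_integ Omega_open Omega_bounded Xf Xg) => x /fg/andP[].
rewrite -subr_ge0 opprK -[X in X + _]mul1r -(integP Omega_open Omega_bounded _ Xf Xg).
rewrite -(mul0r (vol Omega)) -(integ_cst Omega_open).
apply: (le_integ Omega_open Omega_bounded (cspace_cst _ _ 0) (cspaceP _ Xf Xg)).
move=> x /fg/andP[h _].
by rewrite mul1r -lerBlDr sub0r.
Qed.

(** The convention lambda = 0 for a vanishing denominator is harmless: then
    \int f(u) vanishes too. *)
Lemma lambda_cancel : lambda Omega u * integ Omega (fun x => g (u x)) =
  integ Omega (fun x => f (u x)).
Proof.
have [g0|g0] := eqVneq (integ Omega (fun x => g (u x))) 0.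
  rewrite g0 mulr0; move: integ_f_le_g; rewrite g0 normr_le0 => /eqP->//.
by rewrite /lambda divfK.
Qed.

Lemma normr_lambda_le1 : `|lambda Omega u| <= 1.
Proof.
have g_ge0 := le_trans (normr_ge0 _) integ_f_le_g.
rewrite /lambda; have [->|g0] := eqVneq (integ Omega (fun x => g (u x))) 0.
  by rewrite invr0 mulr0 normr0.
rewrite normrM normfV ler_pdivrMr ?normr_gt0// mul1r.
by rewrite [leRHS]ger0_norm.
Qed.

Lemma cspace_nonlin : X (N u).
Proof.
have := cspaceP kappa Xu (cspaceP (- lambda Omega u) Xg Xf).
by apply: cspace_ext => x _; rewrite /nonlin; ring.
Qed.

Lemma nonlin_bound x : K x -> `|N u x| <= kappa.
Proof. by move=> /u1 ux; apply: normr_nonlin_le ux normr_lambda_le1. Qed.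

Lemma integ_nonlin : integ Omega (N u) = kappa * integ Omega u.
Proof.
have XgXf := cspaceP (- lambda Omega u) Xg Xf.
transitivity (integ Omega (fun x =>
    kappa * u x + (- lambda Omega u * g (u x) + f (u x)))).
  by apply: eq_integ => x _; rewrite /nonlin; ring.
rewrite (integP _ _ _ Xu XgXf)// (integP _ _ _ Xg Xf)//.
by rewrite mulNr lambda_cancel addNr addr0.
Qed.

End nonlinear_term.

(** The invariant of the scheme. The maximum bound accompanies the mass because
    the integral of the nonlinear term is under control only below it. *)
Definition conserving u m : Prop :=
  [/\ X u, forall x, K x -> `|u x| <= 1 & integ Omega u = m].

Section duhamel_step.
Variables (u a b : 'rV[R]_d -> R) (m : R).
Hypotheses (Hu : conserving u m) (Xa : X a) (Xb : X b)
  (a_le : forall x, K x -> `|a x| <= kappa)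
  (b_le : forall x, K x -> `|b x| <= kappa)
  (ma : integ Omega a = kappa * m) (mb : integ Omega b = kappa * m).

Let w := duhamel S eps kappa tau
  (fun s x => (1 - s / tau) * a x + s / tau * b x) u.

Let kappa_gt0 : 0 < kappa. Proof. by apply: lt_le_trans kappa_ge4. Qed.

(* The upper bound is kept in the form 0 + tau, that of the domain of
   [curve_integral]. *)
Let D : set R := `[0, 0 + tau]%classic.

Let DP s : D s -> 0 <= s /\ s <= tau.
Proof. by rewrite /D/= add0r in_itv/= => /andP. Qed.

Let theta (s : R) := eps ^+ 2 * (tau - s).
Let decay (s : R) := expR (- kappa * (tau - s)).
Let alpha s := decay s * (1 - s / tau).
Let beta s := decay s * (s / tau).

(* The integrand after S has been distributed over the interpolation; it agrees
   with that of [w] on the closure only, where S is linear. *)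
Let F s x := alpha s * S (theta s) a x + beta s * S (theta s) b x.

Let theta_ge0 s : D s -> 0 <= theta s.
Proof. by move=> /DP[_ s1]; rewrite mulr_ge0 ?sqr_ge0// subr_ge0. Qed.

Let decay_le1 s : D s -> decay s <= 1.
Proof.
move=> /DP[_ s1]; rewrite -expR0 ler_expR mulNr oppr_le0.
by rewrite mulr_ge0 ?subr_ge0// ltW.
Qed.

Let ratio s : D s -> 0 <= s / tau /\ s / tau <= 1.
Proof.
by move=> /DP[s0 s1]; rewrite divr_ge0 ?(ltW tau_gt0)// ler_pdivrMr// mul1r.
Qed.

Let alpha_ge0 s : D s -> 0 <= alpha s.
Proof. by move=> /ratio[_ ?]; rewrite mulr_ge0 ?expR_ge0// subr_ge0. Qed.

Let beta_ge0 s : D s -> 0 <= beta s.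
Proof. by move=> /ratio[? _]; rewrite mulr_ge0 ?expR_ge0. Qed.

Let alphaD s : alpha s + beta s = decay s.
Proof. by rewrite /alpha /beta -mulrDr subrK mulr1. Qed.

Let continuous_ratio : continuous (fun s : R => s / tau).
Proof. by move=> s; apply: cvgM; [exact: cvg_id|exact: cvg_cst]. Qed.

Let uc_alpha : unif_continuous_on D alpha.
Proof.
apply/within_unif_continuous_on/continuous_subspaceT => s.
apply: cvgM; first exact: continuous_decay.
by apply: cvgB; [exact: cvg_cst|exact: continuous_ratio].
Qed.

Let uc_beta : unif_continuous_on D beta.
Proof.
apply/within_unif_continuous_on/continuous_subspaceT => s.
by apply: cvgM; [exact: continuous_decay|exact: continuous_ratio].
Qed.

Let curve_F : curve Omega bc D F.
Proof.
have cS v : X v -> curve Omega bc D (fun s => S (theta s) v).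
  move=> Xv; apply: (@curve_lipschitz_comp _ _ _ _ `[0, eps ^+ 2 * tau]%classic
    D (S ^~ v) theta (eps ^+ 2)).
  - by rewrite exprn_gt0.
  - move=> s /[dup] Ds /DP[s0 _]; rewrite /= in_itv/= theta_ge0//=.
    by rewrite ler_wpM2l ?sqr_ge0// gerBl.
  - move=> s s'; rewrite /theta -mulrBr opprB addrCA addrAC subrr add0r.
    by rewrite normrM ger0_norm ?sqr_ge0// distrC.
  - exact: semigroup_curve.
have S_le v s x : X v -> (forall y, K y -> `|v y| <= kappa) ->
    D s -> K x -> `|S (theta s) v x| <= kappa.
  by move=> Xv vk Ds Kx; apply: (semigroup_le _ HS) => //; exact: theta_ge0.
have c_le (c c' : R -> R) s : D s -> 0 <= c s -> 0 <= c' s ->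
    c s + c' s = decay s -> `|c s| <= 1.
  move=> Ds c0 c'0 cc; rewrite ger0_norm// (le_trans _ (decay_le1 Ds))//.
  by rewrite -cc lerDl.
apply: curveD; apply: (@curveZ _ _ _ _ _ _ _ 1 kappa) => //.
- by move=> s Ds; apply: (c_le alpha beta) => //; [exact: alpha_ge0|exact: beta_ge0].
- exact: cS.
- by move=> s x; exact: S_le.
- move=> s Ds; apply: (c_le beta alpha) => //; [exact: beta_ge0|exact: alpha_ge0|].
  by rewrite addrC.
- exact: cS.
- by move=> s x; exact: S_le.
Qed.

Let w_closure x : K x -> w x = expL S eps kappa tau u x + curve_integral 0 tau F x.
Proof.
move=> Kx; rewrite /w /duhamel /curve_integral add0r; congr (_ + _).
apply: eq_Rintegral => s /set_mem Ds; have {}Ds : D s by rewrite /D add0r.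
rewrite /expL -/(theta s) -/(decay s).
have XZ v c : X v -> X (fun x => c * v x) by move=> ?; exact: cspaceZ.
rewrite (semigroup_linear HS (1 - s / tau) (theta_ge0 Ds) Xa (XZ _ (s / tau) Xb) Kx).
have -> : S (theta s) (fun x => s / tau * b x) x = s / tau * S (theta s) b x.
  have X0 : X (fun=> 0) by exact: cspace_cst.
  transitivity (S (theta s) (fun x => s / tau * b x + 0) x).
    by congr (S _ _ x); apply/funext => y; rewrite addr0.
  rewrite (semigroup_linear HS (s / tau) (theta_ge0 Ds) Xb X0 Kx).
  suff -> : S (theta s) (fun=> 0) x = 0 by rewrite addr0.
  apply/eqP; rewrite -normr_le0.
  apply: (semigroup_le Omega_bounded HS (theta_ge0 Ds) X0) => // y _.
  by rewrite normr0.
by rewrite /F /alpha /beta; ring.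
Qed.

Let X_expL : X (expL S eps kappa tau u).
Proof.
case: Hu => Xu _ _; apply: cspaceZ; apply: (semigroup_cspace HS) => //.
by rewrite mulr_ge0 ?sqr_ge0// ltW.
Qed.

Let Xw : X w.
Proof.
have := cspaceD X_expL (cspace_integral tau_gt0 curve_F).
by apply: cspace_ext => x /w_closure.
Qed.

Let integ_w : integ Omega w = m.
Proof.
have [Xu u1 um] := Hu.
have tau_e0 : 0 <= eps ^+ 2 * tau by rewrite mulr_ge0 ?sqr_ge0// ltW.
rewrite (eq_integ w_closure).
rewrite -[m](subrK (expR (- kappa * tau) * m)) addrC.
have XI := cspace_integral tau_gt0 curve_F.
rewrite (integP Omega_open Omega_bounded _ (semigroup_cspace HS tau_e0 Xu) XI).
rewrite (integ_semigroup Omega_open Omega_bounded HS tau_e0 Xu) um; congr (_ + _).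
rewrite (functional_integral tau_gt0 curve_F (ell := integ Omega) (C := vol Omega)).
- rewrite add0r.
  transitivity (\int[mu]_(s in `[0, tau]) (kappa * decay s * m)).
    apply: eq_Rintegral => s /set_mem Ds; have {}Ds : D s by rewrite /D add0r.
    have XS v : X v -> X (S (theta s) v).
      by move=> Xv; apply: (semigroup_cspace HS) => //; exact: theta_ge0.
    rewrite (integP _ _ _ (XS _ Xa) (cspaceZ _ (XS _ Xb)))//.
    have -> : integ Omega (fun x => beta s * S (theta s) b x) =
        beta s * integ Omega (S (theta s) b).
      have := integP Omega_open Omega_bounded (beta s) (XS _ Xb) (cspace_cst Omega bc 0).
      rewrite integ_cst// mul0r addr0 => <-.
      by apply: eq_integ => x _; rewrite addr0.
    rewrite !(integ_semigroup _ _ HS (theta_ge0 Ds))// ma mb -mulrDl alphaD.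
    by ring.
  rewrite RintegralZr ?Rintegral_expR_kernel//; first by rewrite mulrBl mul1r.
  apply: continuous_compact_integrable; first exact: segment_compact.
  apply: continuous_subspaceT => s.
  by apply: cvgM; [exact: cvg_cst|exact: continuous_decay].
- by rewrite fine_ge0.
- by move=> c v v' Xv Xv'; exact: (integP Omega_open Omega_bounded c Xv Xv').
- by move=> v M Xv vM; exact: (normr_integ_le Omega_open Omega_bounded Xv vM).
Qed.

Let w_le1 x : K x -> `|w x| <= 1.
Proof.
move=> Kx; have [Xu u1 _] := Hu.
have tau_e0 : 0 <= eps ^+ 2 * tau by rewrite mulr_ge0 ?sqr_ge0// ltW.
rewrite w_closure// (le_trans (ler_normD _ _))//.
rewrite -[leRHS](subrK (expR (- kappa * tau))) [leRHS]addrC lerD//.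
  rewrite /expL normrM ger0_norm ?expR_ge0// ger_pMr ?expR_gt0//.
  exact: (semigroup_le Omega_bounded HS tau_e0 Xu u1).
have iF := unif_continuous_on_integrable (curve_eval curve_F Kx).
rewrite -(@Rintegral_expR_kernel _ kappa tau)// /curve_integral.
rewrite add0r in iF *.
apply: le_trans (le_normr_Rintegral _ iF) _ => //.
apply: le_Rintegral => //.
- exact: (integrable_norm iF).
- apply: continuous_compact_integrable; first exact: segment_compact.
  apply: continuous_subspaceT => s.
  by apply: cvgM; [exact: cvg_cst|exact: continuous_decay].
- move=> s Ds; have {}Ds : D s by rewrite /D add0r.
  rewrite -/(decay s) -alphaD mulrDr (le_trans (ler_normD _ _))//.
  rewrite [`|alpha s * _|]normrM [`|beta s * _|]normrM.
  rewrite (ger0_norm (alpha_ge0 Ds)) (ger0_norm (beta_ge0 Ds)).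
  rewrite ![kappa * _]mulrC lerD// ler_wpM2l ?alpha_ge0 ?beta_ge0//.
    exact: (semigroup_le Omega_bounded HS (theta_ge0 Ds) Xa a_le).
  exact: (semigroup_le Omega_bounded HS (theta_ge0 Ds) Xb b_le).
Qed.

(** For both the bound and the mass, the weights [alpha] and [beta] sum to the
    kernel e^{- kappa (tau - s)}, whose integral times kappa is
    1 - e^{- kappa tau}. *)
Lemma duhamel_conserving : conserving w m.
Proof. by split=> //; exact: w_le1. Qed.

End duhamel_step.

(** The first-order step is the case a = b, where the interpolation is
    constant. *)
Lemma etd1_conserving u m : conserving u m ->
  conserving (etd1_step Omega S eps kappa tau u) m.
Proof.
move=> Hu; have [Xu u1 um] := Hu.
have mN : integ Omega (N u) = kappa * m by rewrite integ_nonlin// um.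
have := duhamel_conserving Hu (cspace_nonlin Xu) (cspace_nonlin Xu)
  (nonlin_bound Xu u1) (nonlin_bound Xu u1) mN mN.
rewrite (_ : (fun s x => _) = fun=> N u)//.
by apply/funext => s; apply/funext => x; rewrite -mulrDl subrK mul1r.
Qed.

Lemma etdrk2_conserving u m : conserving u m ->
  conserving (etdrk2_step Omega S eps kappa tau u) m.
Proof.
move=> Hu; have [Xu u1 um] := Hu; have [Xv v1 vm] := etd1_conserving Hu.
apply: duhamel_conserving Hu (cspace_nonlin Xu) (cspace_nonlin Xv)
  (nonlin_bound Xu u1) (nonlin_bound Xv v1) _ _.
  by rewrite integ_nonlin// um.
by rewrite integ_nonlin// vm.
Qed.

End scheme.

Theorem proposition2 (R : realType) (d : nat) (hd : d = 2%N \/ d = 3%N)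
    (Omega : set 'rV[R]_d) (bc : boundary_condition R d)
    (Omega_open : open Omega) (Omega_connected : connected Omega)
    (Omega_bounded : bounded_set Omega)
    (Omega_lipschitz : lipschitz_boundary Omega)
    (Omega_periodic : periodic_domain bc Omega)
    (S : R -> ('rV[R]_d -> R) -> 'rV[R]_d -> R)
    (S_semigroup : laplacian_semigroup bc Omega S)
    (eps : R) (eps_gt0 : 0 < eps)
    (u0 : 'rV[R]_d -> R) (u0_admissible : cspace bc Omega u0)
    (u0_le1 : supnorm Omega u0 <= 1)
    (u0_mass : `|integ Omega u0| != vol Omega)
    (kappa : R) (kappa_ge : kappa_min R <= kappa)
    (tau : R) (tau_gt0 : 0 < tau) :
  forall n, integ Omega (etdrk2 Omega S eps kappa tau u0 n) = integ Omega u0.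
Proof.
rewrite kappa_minE in kappa_ge => n.
suff [] : conserving Omega bc (etdrk2 Omega S eps kappa tau u0 n) (integ Omega u0) by [].
elim: n => [|n IH]; last exact: (etdrk2_conserving _ _ S_semigroup).
split=> // x Kx; apply: le_trans u0_le1.
exact: (le_supnorm Omega_bounded u0_admissible Kx).
Qed.
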